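(* Let $\gamma>0$ and $f$ satisfying (F) be given (known). Then, for smooth solutions $(\phi,\mu)$ of the Cahn-Hilliard system on $[0,T]\times\Omega$, the mobility $b$ is determined uniquely from observations of $\phi(\cdot,t)$ and $\partial_t\phi(\cdot,t)$ on the set $$\widetilde R_t=\{s=\phi(x,t): x\in\Omega \text{ and } \nabla\mu(x,t)\neq0\}.$$ That is: let $b_1,b_2$ be two functions satisfying (B), and for $i=1,2$ let $(\phi_i,\mu_i)$ be a smooth periodic solution on $[0,T]\times\Omega$ of $$\partial_t\phi_i=\operatorname{div}\big(b_i(\phi_i)\nabla\mu_i\big),\qquad \mu_i=-\gamma\Delta\phi_i+f(\phi_i).$$ If $t\in[0,T]$ is such that $\phi_1(\cdot,t)=\phi_2(\cdot,t)=:\phi(\cdot,t)$ and $\partial_t\phi_1(\cdot,t)=\partial_t\phi_2(\cdot,t)$ on $\Omega$ (so that also $\mu_1(\cdot,t)=\mu_2(\cdot,t)=:\mu(\cdot,t)$), then $b_1(s)=b_2(s)$ for all $s\in\widetilde R_t$.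
   Context: $\Omega$ is the $d$-dimensional torus $\mathbb{T}^d$, $d\in\{1,2,3\}$; all functions on $\Omega$ are periodic. (B): $b:\mathbb{R}\to\mathbb{R}_+$, $b\in C^2(\mathbb{R})$, and there are constants $\beta_1,\beta_2,\beta_3,\beta_4$ with $0<\beta_1\le b(s)\le\beta_2$ for all $s$, $\|b'\|_\infty\le\beta_3$, $\|b''\|_\infty\le\beta_4$. (F): $f=F'$ with $F\in C^4(\mathbb{R})$ such that $F(s)\ge-\kappa$ and $F''(s)\ge-\kappa$ for all $s$ and some $\kappa\ge0$, and $|F^{(k)}(s)|\le p_k+q_k|s|^{4-k}$ for $0\le k\le4$ and all $s$, with constants $p_k,q_k\ge0$. The Cahn-Hilliard system with parameters $(\gamma,b,f)$ is $\partial_t\phi=\operatorname{div}(b(\phi)\nabla\mu)$, $\mu=-\gamma\Delta\phi+f(\phi)$ on $\Omega$ with periodic boundary conditions. *)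

(* Defs.v *)
(* The torus T^d = R^d / Z^d is not introduced as a
   type: functions on it are the functions on R^d ('rV[R]_d) that are
   1-periodic in each coordinate. *)
From HB Require Import structures.
From mathcomp Require Import all_boot all_order all_algebra.
From mathcomp Require Import all_classical all_reals all_analysis.
Set Implicit Arguments.
Unset Strict Implicit.
Unset Printing Implicit Defensive.
Import Order.TTheory GRing.Theory Num.Theory.
Import numFieldNormedType.Exports.
Local Open Scope ring_scope.
Local Open Scope classical_set_scope.

Definition class_C (R : realType) (k : nat) (g : R -> R) : Prop :=
  (forall j, (j < k)%N -> forall s, derivable g^`(j) s 1) /\
  continuous g^`(k).

Definition condB (R : realType) (b : R -> R) : Prop :=
  class_C 2 b /\
  exists beta1 beta2 beta3 beta4 : R,
    [/\ 0 < beta1,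
        forall s, beta1 <= b s <= beta2,
        forall s, `|b^`() s| <= beta3
      & forall s, `|b^`(2) s| <= beta4].

Definition condF (R : realType) (f : R -> R) : Prop :=
  exists F : R -> R,
    [/\ f = F^`(),
        class_C 4 F,
        exists kappa : R, 0 <= kappa /\
          forall s, - kappa <= F s /\ - kappa <= F^`(2) s
      & exists p q : nat -> R, forall k, (k <= 4)%N ->
          [/\ 0 <= p k, 0 <= q k &
              forall s, `|F^`(k) s| <= p k + q k * `|s| ^+ (4 - k)]].

Section space.
Variables (R : realType) (d : nat).
Implicit Types (u : 'rV[R]_d -> R) (V : 'rV[R]_d -> 'rV[R]_d).

Definition basis_vec (i : 'I_d) : 'rV[R]_d := delta_mx 0 i.

Definition torus_periodic u : Prop := forall i, periodic u (basis_vec i).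

Definition partial (i : 'I_d) u : 'rV[R]_d -> R :=
  fun x => 'D_(basis_vec i) u x.

Definition grad u : 'rV[R]_d -> 'rV[R]_d := fun x => \row_i partial i u x.

Definition div V : 'rV[R]_d -> R :=
  fun x => \sum_(i < d) partial i (fun y => V y 0 i) x.

Definition laplacian u : 'rV[R]_d -> R := div (grad u).

Definition partials (l : seq 'I_d) u : 'rV[R]_d -> R := foldr partial u l.

End space.

Section space_time.
Variables (R : realType) (d : nat) (T : R).
Implicit Types u : R -> 'rV[R]_d -> R.

Definition diff_quotient u (t : R) (x : 'rV[R]_d) : R -> R :=
  fun s => (s - t)^-1 * (u s x - u t x).

(* The time derivative is taken inside [0, T], hence is one-sided at t = 0
   and t = T; the values of u at times outside [0, T] play no role. *)
Definition dt u (t : R) (x : 'rV[R]_d) : R :=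
  lim (diff_quotient u t x @ within `[0, T] t^').

Definition dt_exists u : Prop :=
  forall t x, 0 <= t <= T ->
    cvg (diff_quotient u t x @ within `[0, T] t^').

Definition jointly_continuous u : Prop :=
  {within `[0, T] `*` [set: 'rV[R]_d],
     continuous (fun z : R * 'rV[R]_d => u z.1 z.2)}.

(* u and its iterated partial derivatives in x up to order k exist and are
   continuous on [0, T] x R^d. *)
Definition space_class_C (k : nat) u : Prop :=
  (forall (l : seq 'I_d) (i : 'I_d) t x, (size l < k)%N -> 0 <= t <= T ->
     derivable (partials l (u t)) x (basis_vec R i)) /\
  (forall l : seq 'I_d, (size l <= k)%N ->
     jointly_continuous (fun t => partials l (u t))).

(* Since b is only C^2 and f only C^3, "smooth" is read as: every derivative
   occurring in the system exists classically and is continuous on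
   [0, T] x T^d.  In particular C^oo solutions are covered. *)
Record smooth_CH_solution (gamma : R) (b f : R -> R)
    (phi mu : R -> 'rV[R]_d -> R) : Prop := {
  CH_periodic_phi : forall t, 0 <= t <= T -> torus_periodic (phi t);
  CH_periodic_mu : forall t, 0 <= t <= T -> torus_periodic (mu t);
  CH_phi_dt : dt_exists phi;
  CH_phi_dt_continuous : jointly_continuous (dt phi);
  CH_phi_space : space_class_C 4 phi;
  CH_mu_space : space_class_C 2 mu;
  CH_mass : forall t x, 0 <= t <= T ->
    dt phi t x = div (fun y => b (phi t y) *: grad (mu t) y) x;
  CH_potential : forall t x, 0 <= t <= T ->
    mu t x = - gamma * laplacian (phi t) x + f (phi t x)
}.

End space_time.

Definition observed_range (R : realType) (d : nat) (phi mu : 'rV[R]_d -> R) :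
    set R :=
  phi @` [set x | grad mu x != 0].

(* Main.v *)
Require Import Defs.
From HB Require Import structures.
From mathcomp Require Import all_boot all_order all_algebra.
From mathcomp Require Import all_classical all_reals all_analysis.
From mathcomp Require Import ring lra.
Set Implicit Arguments.
Unset Strict Implicit.
Unset Printing Implicit Defensive.
Import Order.TTheory GRing.Theory Num.Theory.
Import numFieldNormedType.Exports.
Local Open Scope ring_scope.
Local Open Scope classical_set_scope.

(** Write [phi], [mu] for the common state and potential at time [t], and put
    [a := (b1 - b2) o phi].  Subtracting the two mass balances gives
    [div (a grad mu) = 0] on the torus, and the claim becomes [a grad mu = 0]
    everywhere ([solenoidal_scaled_grad_eq0]).

    Testing this equation with [mu] gives [int a |grad mu|^2 = 0], which is
    useless because [a] may change sign.  But [a] may be replaced by any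
    function [eta(a)] with [eta] differentiable: since
    [a lap mu = - grad a . grad mu], one has
    [div (eta(a) grad mu) = (eta(a) - a eta'(a)) lap mu], and the right-hand
    side vanishes when [eta] is homogeneous of degree one.  The choice
    [eta = |.|] would give [int |a| |grad mu|^2 = 0], hence the claim.  As
    [|.|] is not differentiable at 0, one takes
    [eta_eps(s) = sqrt (s^2 + eps^2)] instead, for which the defect
    [eta - s eta' = eps^2 / eta] lies between 0 and [eps]; thus
    [|a| |grad mu|^2 <= div (mu eta_eps(a) grad mu) + eps |mu| |lap mu|]
    pointwise ([smooth_abs_weight_bound]), and [eps] tends to 0.

    The only facts about integration over the torus that this uses are that
    the integral is positive and linear, that it kills derivatives of periodic
    functions, and that it is nonzero on nonzero nonnegative continuous
    functions.  All of them hold, the second one in the limit, for averages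
    over the points [x + k / N], [k] in [{0, ..., N-1}^d], and these averages
    replace the integral: a translation by [1 / N] along an axis permutes the
    lattice up to periods, so difference quotients of step [1 / N] average to 0,
    and they are uniformly close to the partial derivative
    ([lattice_mean_partial]); a bump of fixed size contains a fixed proportion
    of the lattice ([lattice_mean_ge]).  Both are combined in
    [eq0_of_approx_divergence]. *)

(** * Directional derivatives and uniform continuity *)

(** Uniform continuity on a compact set; the translated point [x + h] may leave
    [A]. *)
Lemma near_translation (R : realType) (V : normedModType R) (A : set V)
    (g : V -> R) (eps : R) :
  compact A -> continuous g -> 0 < eps ->
  \forall h \near (0 : V), A `<=` [set x | `|g x - g (x + h)| < eps].
Proof.
move=> /compact_near_coveringP cptA cg eps0; apply: cptA => x _.
suff: (g y.1 - g (y.1 + y.2)) @[y --> (x, 0)] --> (0 : R).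
  move=> /cvgr0Pnorm_lt /(_ _ eps0); apply: filterS => -[y h] /=; exact.
have -> : (0 : R) = g x - g (x + 0) by rewrite addr0 subrr.
have fst_x : y.1 @[y --> (x, 0 : V)] --> x by exact: cvg_fst.
have snd_0 : y.2 @[y --> (x, 0 : V)] --> (0 : V) by exact: cvg_snd.
apply: cvgB; first exact: (cvg_comp _ _ fst_x (cg x)).
exact: (cvg_comp _ _ (cvgD fst_x snd_0) (cg _)).
Qed.

Section directional.
Variables (R : realType) (V : normedModType R).

(** The difference quotients on both sides are the same function, so
    one-variable calculus applies to directional derivatives. *)
Lemma is_derive_line (g : V -> R) (x v : V) (k dg : R) :
  is_derive (k *: v + x) v g dg <->
  is_derive k 1 (fun h : R => g (h *: v + x)) dg.
Proof.
have E : (fun h : R => h^-1 *: ((g \o shift (k *: v + x)) (h *: v) -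
                                g (k *: v + x))) =
         (fun h : R => h^-1 *: (((fun l : R => g (l *: v + x)) \o shift k)
                                  (h *: 1) - g (k *: v + x))).
  by apply/funext => h /=; rewrite addrA -scalerDl [_ *: 1]mulr1.
by split=> -[dx vx]; apply: DeriveDef; move: dx vx;
  rewrite /derivable /derive E.
Qed.

Lemma is_derive_comp_dir (h : R -> R) (g : V -> R) (x v : V) (dh dg : R) :
  is_derive (g x) 1 h dh -> is_derive x v g dg ->
  is_derive x v (h \o g) (dh * dg).
Proof.
have E : x = (0 : R) *: v + x by rewrite scale0r add0r.
rewrite {2 3}E => Hh /is_derive_line Hg; apply/is_derive_line.
apply: (@is_derive1_comp _ h (fun k => g (k *: v + x)) 0 dh dg) => //.
by rewrite -E.
Qed.

Lemma MVT_line (g : V -> R) (x v : V) (h : R) :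
  0 <= h -> (forall y, derivable g y v) ->
  exists2 th : R, 0 <= th <= h &
    g (x + h *: v) - g x = 'D_v g (x + th *: v) * h.
Proof.
move=> h0 dg.
have dl (k : R) :
    is_derive k 1 (fun k => g (k *: v + x)) ('D_v g (k *: v + x)).
  exact/is_derive_line/derivableP.
have := @MVT_segment _ (fun k => g (k *: v + x)) _ 0 h h0 (fun k _ => dl k) _.
case=> [|th].
  apply: derivable_within_continuous => k _; exact: ex_derive.
rewrite in_itv /= scale0r add0r subr0 ![_ *: v + x]addrC => thh E.
by exists th.
Qed.
End directional.

(** * Averages over lattices of the torus *)

Section lattice.
Variables (R : realType) (d : nat).
Implicit Types (g : 'rV[R]_d -> R) (x : 'rV[R]_d) (i : 'I_d).

Definition lattice_point x N (k : {ffun 'I_d -> 'I_N}) : 'rV[R]_d :=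
  x + \row_i ((k i)%:R / N%:R).

(** A Riemann sum for the integral of [g] over the torus.  The lattice starts at
    an arbitrary [x], so that the point where a function is to be shown to
    vanish is a lattice point for every [N]. *)
Definition lattice_mean x N g : R :=
  (N ^ d)%:R^-1 * \sum_(k : {ffun 'I_d -> 'I_N}) g (lattice_point x k).

Definition unit_box x : set 'rV[R]_d :=
  [set y | forall i, `[x 0 i, x 0 i + 1]%classic (y 0 i)].

Lemma compact_unit_box x : compact (unit_box x).
Proof.
by apply: (@rV_compact _ _ (fun i => `[x 0 i, x 0 i + 1]%classic)) => i;
  exact: segment_compact.
Qed.

Lemma lattice_point_in_box x N (k : {ffun 'I_d -> 'I_N}) :
  unit_box x (lattice_point x k).
Proof.
move=> i; rewrite /= in_itv /= !mxE lerDl lerD2l divr_ge0 //=.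
case: N k => [k|N k]; first by case: (k i).
by rewrite ler_pdivrMr ?ltr0n // mul1r ler_nat ltnW.
Qed.

Lemma lattice_card_gt0 N : 0 < (N.+1 ^ d)%:R :> R.
Proof. by rewrite ltr0n expn_gt0. Qed.

Lemma lattice_meanD x N g1 g2 :
  lattice_mean x N (fun y => g1 y + g2 y) =
  lattice_mean x N g1 + lattice_mean x N g2.
Proof. by rewrite /lattice_mean big_split mulrDr. Qed.

Lemma lattice_mean_sum x N (I : finType) (g : I -> 'rV[R]_d -> R) :
  lattice_mean x N (fun y => \sum_i g i y) = \sum_i lattice_mean x N (g i).
Proof. by rewrite /lattice_mean exchange_big mulr_sumr. Qed.

Lemma lattice_meanZ x N c g :
  lattice_mean x N (fun y => c * g y) = c * lattice_mean x N g.
Proof. by rewrite /lattice_mean -mulr_sumr mulrCA. Qed.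

Lemma le_lattice_mean x N g1 g2 :
  (forall y, unit_box x y -> g1 y <= g2 y) ->
  lattice_mean x N g1 <= lattice_mean x N g2.
Proof.
move=> le12; rewrite ler_wpM2l ?invr_ge0 //.
by apply: ler_sum => k _; exact/le12/lattice_point_in_box.
Qed.

Lemma lattice_mean_cst x N c : lattice_mean x N.+1 (fun=> c) = c.
Proof.
rewrite /lattice_mean sumr_const card_ffun !card_ord -[c *+ _]mulr_natl mulrA.
by rewrite mulVf ?mul1r // gt_eqF ?lattice_card_gt0.
Qed.

(** Discrete translation invariance of the integral over the torus. *)
Lemma lattice_mean_shift x N g i : torus_periodic g ->
  lattice_mean x N.+1 (fun y => g (y + N.+1%:R^-1 *: basis_vec R i)) =
  lattice_mean x N.+1 g.
Proof.
move=> pg; rewrite /lattice_mean; congr (_ * _).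
pose rot (s : 'I_N.+1 -> 'I_N.+1) (k : {ffun 'I_d -> 'I_N.+1}) :=
  [ffun j => if j == i then s (k j) else k j].
have rotK s s' : cancel s s' -> cancel (rot s) (rot s').
  by move=> ss' k; apply/ffunP => j; rewrite !ffunE; case: eqP.
rewrite [RHS](reindex (rot (@ordS _))) /=; last first.
  by apply: onW_bij; exists (rot (@ord_pred _)); apply: rotK;
    [exact: ordSK | exact: ord_predK].
apply: eq_bigr => k _.
(* The step leaves the box exactly when the index is the last one; it then
   overshoots the rotated point by a full period. *)
have [ki|ki] := ltnP (k i).+1 N.+1.
  congr g; apply/rowP => j; rewrite !mxE ffunE -addrA; congr (_ + _).
  rewrite eqxx /=; case: eqP => [->|_] /=; last by rewrite mulr0 addr0.
  by rewrite modn_small // mulr1 -[in RHS]natr1 mulrDl mul1r.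
rewrite -[RHS](pg i); congr g; apply/rowP => j.
rewrite !mxE ffunE -!addrA; congr (_ + _).
rewrite !eqxx /=; case: eqP => [->|_] /=; last by rewrite mulr0 !addr0.
have -> : k i = N :> nat.
  by apply/eqP; rewrite eqn_leq -ltnS ltn_ord.
by rewrite modnn mul0r add0r mulr1 -[X in _ + X]mul1r -mulrDl natr1 divff.
Qed.

(** Discrete form of [int partial_i g = 0].  By the mean value theorem the
    difference quotient of step [1 / N] at [y] is the value of [partial i g] at
    a point within [1 / N] of [y], so it differs little from [partial i g y],
    uniformly over the box; and its average is 0 by translation invariance. *)
Lemma lattice_mean_partial x g i :
  torus_periodic g -> (forall y, derivable g y (basis_vec R i)) ->
  continuous (partial i g) ->
  lattice_mean x N (partial i g) @[N --> \oo] --> 0.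
Proof.
move=> pg dg cg; apply/cvgr0Pnorm_le => eps eps0.
have /nbhs_ballP[r /= r0 Hr] :=
  near_translation (@compact_unit_box x) cg eps0.
apply: near_inftyS; near=> N.
have Nr : N.+1%:R^-1 < r.
  by near: N; exact: (near_infty_natSinv_lt (PosNum r0)).
set e := basis_vec R i; set h : R := N.+1%:R^-1.
have h0 : 0 < h by rewrite invr_gt0.
have zero : lattice_mean x N.+1 (fun y => h^-1 * (g (y + h *: e) - g y)) = 0.
  rewrite lattice_meanZ lattice_meanD lattice_mean_shift //.
  rewrite (_ : (fun y => - g y) = (fun y => -1 * g y)).
    by rewrite lattice_meanZ mulN1r subrr mulr0.
  by apply/funext => y; rewrite mulN1r.
have close y : unit_box x y ->
    `|partial i g y - h^-1 * (g (y + h *: e) - g y)| <= eps.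
  move=> yA; have [th /andP[th0 thh] ->] := MVT_line y (ltW h0) dg.
  rewrite mulrCA mulVf ?gt_eqF // mulr1; apply/ltW/Hr => //.
  split=> // i0 j; rewrite ord1 !mxE /ball /= sub0r normrN.
  apply: (@le_lt_trans _ _ h); last exact: Nr.
  by case: (j == i); rewrite ?mulr1 ?mulr0 ?normr0 ?ger0_norm // ltW.
have -> : lattice_mean x N.+1 (partial i g) = lattice_mean x N.+1
    (fun y => partial i g y - h^-1 * (g (y + h *: e) - g y)).
  rewrite lattice_meanD -[LHS]addr0; congr (_ + _); apply/esym.
  rewrite -[RHS]oppr0 -[in RHS]zero -mulN1r -lattice_meanZ.
  by congr (lattice_mean _ _ _); apply/funext => y; rewrite mulN1r.
rewrite ler_norml -{1}(lattice_mean_cst x N (- eps)).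
rewrite -{2}(lattice_mean_cst x N eps).
by apply/andP; split; apply: le_lattice_mean => y /close;
  rewrite ler_norml => /andP[].
Unshelve. all: by end_near.
Qed.

(** Near [x], [g] is at least [g x / 2].  Only multiples [N] of a fixed [M.+1]
    with [1 / M.+1] small are considered: then the cube of side [1 / M.+1] at
    [x] holds exactly one lattice point in [M.+1 ^ d], whatever [N]. *)
Lemma lattice_mean_ge x g :
  {for x, continuous g} -> (forall y, 0 <= g y) -> 0 < g x ->
  exists2 delta : R, 0 < delta &
    exists M, forall K, delta <= lattice_mean x (M.+1 * K.+1) g.
Proof.
move=> cg g0 gx0.
have gx2 : 0 < g x / 2 by rewrite divr_gt0.
move: cg => /cvgrPdist_lt /(_ _ gx2) /nbhs_ballP[r /= r0 Hr].
have [M _ HM] := @near_infty_natSinv_lt R (PosNum r0).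
have {HM} /= HM := HM M (leqnn M).
exists (g x / 2 / (M.+1 ^ d)%:R).
  by rewrite divr_gt0 // lattice_card_gt0.
exists M => K; set N := (M.+1 * K.+1)%N.
pose A := [pred j : 'I_N | (j < K.+1)%N].
have cardA : #|A| = K.+1.
  rewrite -sum1_card (big_ord_narrow (leq_pmull _ _)) //.
  by rewrite sum1_card card_ord.
have near_x (k : {ffun 'I_d -> 'I_N}) : k \in ffun_on A ->
    g x / 2 <= g (lattice_point x k).
  move=> /ffun_onP kA.
  have /Hr : ball x r (lattice_point x k).
    split=> // i0 i; rewrite ord1 !mxE /ball /= opprD addrA subrr add0r normrN.
    rewrite ger0_norm ?divr_ge0 //; apply: le_lt_trans HM.
    rewrite ler_pdivrMr ?ltr0n // /N natrM mulKf ?pnatr_eq0 // ler_nat.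
    exact/ltnW/kA.
  rewrite /= => /ltr_normlW; lra.
rewrite /lattice_mean mulrC.
apply: (@le_trans _ _ ((N ^ d)%:R^-1 *
    \sum_(k : {ffun 'I_d -> 'I_N} | k \in ffun_on A) (g x / 2))).
  rewrite sumr_const card_ffun_on cardA card_ord -[(g x / 2) *+ _]mulr_natl.
  by rewrite /N expnMn natrM invfM -mulrA mulKf // gt_eqF ?lattice_card_gt0.
rewrite ler_wpM2l ?invr_ge0 // [leRHS](bigID (mem (ffun_on A))) /=.
by rewrite ler_wpDr ?sumr_ge0 //; apply: ler_sum => k; exact: near_x.
Qed.
End lattice.

(** * Continuously differentiable functions on the torus *)

Section torus_C1.
Variables (R : realType) (d : nat).
Implicit Types (u v : 'rV[R]_d -> R) (x : 'rV[R]_d) (i : 'I_d).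

Definition torus_C1 u : Prop :=
  [/\ torus_periodic u, continuous u,
      forall i x, derivable u x (basis_vec R i) &
      forall i, continuous (partial i u)].

Lemma is_derive_partial u x i : torus_C1 u ->
  is_derive x (basis_vec R i) u (partial i u x).
Proof. by move=> [_ _ du _]; exact/derivableP. Qed.

Lemma partialM u v i : torus_C1 u -> torus_C1 v ->
  partial i (fun y => u y * v y) =
  (fun y => u y * partial i v y + v y * partial i u y).
Proof.
move=> uC vC; apply/funext => x; apply: derive_val.
exact: (is_deriveM (is_derive_partial x i uC) (is_derive_partial x i vC)).
Qed.

Lemma torus_C1M u v : torus_C1 u -> torus_C1 v ->
  torus_C1 (fun y => u y * v y).
Proof.
move=> uC vC; have [pu cu du cdu] := uC; have [pv cv dv cdv] := vC; split.
- by move=> i x; rewrite pu pv.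
- by move=> x; exact: (cvgM (cu x) (cv x)).
- move=> i x; exact: (derivableM (du i x) (dv i x)).
- move=> i; rewrite partialM // => x.
  exact: (cvgD (cvgM (cu x) (cdv i x)) (cvgM (cv x) (cdu i x))).
Qed.

Section composition.
Variables (h dh : R -> R) (u : 'rV[R]_d -> R).
Hypothesis hD : forall s : R, is_derive s 1 h (dh s).
Hypothesis dh_cont : continuous dh.
Hypothesis uC : torus_C1 u.

Lemma partial_comp i :
  partial i (fun y => h (u y)) = (fun y => dh (u y) * partial i u y).
Proof.
apply/funext => x; apply: derive_val.
exact: (is_derive_comp_dir (hD (u x)) (is_derive_partial x i uC)).
Qed.

Lemma torus_C1_comp : torus_C1 (fun y => h (u y)).
Proof.
have [pu cu du cdu] := uC; split.
- by move=> i x; rewrite pu.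
- move=> x; apply: (cvg_comp u h (cu x)).
  have /derivable1_diffP/differentiable_continuous : derivable h (u x) (1 : R).
    exact: ex_derive.
  exact.
- move=> i x; apply: (@ex_derive _ _ _ _ _ _ (dh (u x) * partial i u x)).
  exact: (is_derive_comp_dir (hD (u x)) (is_derive_partial x i uC)).
- move=> i; rewrite partial_comp => x.
  have cdh : dh (u y) @[y --> x] --> dh (u x)
    by apply: (cvg_comp u dh (cu x)); exact: dh_cont.
  exact: (cvgM cdh (cdu i x)).
Qed.
End composition.

(** The integral of [P] is at most [eps] times that of [Q], for every [eps]; as
    [P] is nonnegative and continuous, it vanishes.  With averages in place of
    integrals: if [P x > 0], the averages of [P] from [x] stay above some
    [delta] along a sequence of lattices, and [eps := delta / (2 K)], with [K] a
    bound of [Q] on the box, contradicts this on a lattice so fine that the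
    divergence averages below [delta / 3]. *)
Lemma eq0_of_approx_divergence (P Q : 'rV[R]_d -> R) :
  continuous P -> continuous Q -> (forall x, 0 <= P x) ->
  (forall eps : R, 0 < eps -> exists2 W : 'I_d -> 'rV[R]_d -> R,
     forall i, torus_C1 (W i) &
     forall x, P x <= \sum_i partial i (W i) x + eps * Q x) ->
  forall x, P x = 0.
Proof.
move=> cP cQ P0 PW x; apply/eqP; rewrite eq_le P0 andbT leNgt; apply/negP => Px.
have [delta delta0 [M HM]] := lattice_mean_ge (cP x) P0 Px.
have [c _ Qc] : exists2 c, c \in unit_box x &
    forall y, y \in unit_box x -> Q y <= Q c.
  apply: EVT_max_rV (@compact_unit_box _ _ x) (continuous_subspaceT cQ).
  by exists x => i; rewrite /= in_itv /= lexx lerDl ler01.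
pose K := Num.max (Q c) 1.
have K0 : 0 < K by rewrite lt_max ltr01 orbT.
have QK y : unit_box x y -> Q y <= K.
  by move=> yA; rewrite le_max Qc ?inE.
have eps0 : 0 < delta / 2 / K by rewrite !divr_gt0.
have [W WC PWQ] := PW _ eps0.
have small : \sum_i lattice_mean x N (partial i (W i)) @[N --> \oo] --> (0 : R).
  have W0 i : lattice_mean x N (partial i (W i)) @[N --> \oo] --> (0 : R).
    by have [pW _ dW cW] := WC i; exact: lattice_mean_partial.
  have := @cvg_big R _ +%R 0 xpredT (@add_continuous R) nat \oo
    (index_enum 'I_d) _ _ _ (fun i _ => W0 i).
  by rewrite big1 //; apply.
have d3 : 0 < delta / 3 by rewrite divr_gt0.
move: small => /cvgr0Pnorm_lt /(_ _ d3) [N0 _ HN].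
have {}HN := HN (M.+1 * N0.+1)%N
  (leq_trans (leqnSn _) (leq_pmull _ (ltn0Sn _))).
have : lattice_mean x (M.+1 * N0.+1) P <=
    \sum_i lattice_mean x (M.+1 * N0.+1) (partial i (W i)) + delta / 2.
  rewrite -(lattice_mean_cst x (M.+1 * N0.+1).-1 (delta / 2)) prednK //.
  rewrite -lattice_mean_sum -lattice_meanD; apply: le_lattice_mean => y yA.
  apply: (le_trans (PWQ y)); rewrite lerD2l -[leRHS](divfK (lt0r_neq0 K0)).
  by rewrite ler_wpM2l ?QK // ltW.
have := HM N0; move: HN => /ltr_normlW; lra.
Qed.

End torus_C1.

(** * Divergence-free fields of the form a grad mu *)

Section degenerate_flux.
Variables (R : realType) (d : nat).
Implicit Types (a mu : 'rV[R]_d -> R) (x : 'rV[R]_d) (i : 'I_d).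

Definition smooth_abs (eps s : R) : R := Num.sqrt (s ^+ 2 + eps ^+ 2).

Lemma smooth_abs_gt0 eps s : 0 < eps -> 0 < smooth_abs eps s.
Proof. by move=> e0; rewrite sqrtr_gt0 ltr_wpDl ?sqr_ge0 ?exprn_gt0. Qed.

Lemma sqr_smooth_abs eps s : smooth_abs eps s ^+ 2 = s ^+ 2 + eps ^+ 2.
Proof. by rewrite sqr_sqrtr // addr_ge0 ?sqr_ge0. Qed.

Lemma is_derive_smooth_abs eps (s : R) : 0 < eps ->
  is_derive s 1 (smooth_abs eps) (s / smooth_abs eps s).
Proof.
move=> e0.
have q0 : 0 < s ^+ 2 + eps ^+ 2 by rewrite ltr_wpDl ?sqr_ge0 ?exprn_gt0.
have dq : is_derive s 1 (fun z : R => z ^+ 2 + eps ^+ 2) (2 * s).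
  by apply: is_derive_eq; rewrite addr0 [_%:A]mulr1 mulr_natl mulr2n.
have H := @is_derive1_comp _ _ _ s _ _ (is_derive1_sqrt q0) dq.
apply: (is_derive_eq H); rewrite -/(smooth_abs eps s).
have := smooth_abs_gt0 s e0 => /lt0r_neq0 r0; field; exact: r0.
Qed.

Lemma continuous_derive_smooth_abs eps : 0 < eps ->
  continuous (fun s : R => s / smooth_abs eps s).
Proof.
move=> e0 s; have := smooth_abs_gt0 s e0 => /lt0r_neq0 r0.
apply: cvgM; first exact: cvg_id.
apply: cvgV => //.
have /derivable1_diffP/differentiable_continuous :
    derivable (smooth_abs eps) s (1 : R).
  by apply: ex_derive; exact: is_derive_smooth_abs.
exact.
Qed.

(** Pointwise estimate behind the choice of weight.  At a point, [r] stands for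
    [smooth_abs eps a], [m] for [mu], [L] for [lap mu], [g] for
    [grad mu . grad a] and [S] for [|grad mu|^2], so that the first two terms on
    the right form the divergence of [mu r grad mu].  Using
    [g = - a L], the factor of [m] is
    [L (r - a^2 / r) = L eps^2 / r], at most [eps |L|] since [eps <= r]. *)
Lemma smooth_abs_weight_bound (eps a r g m L S : R) :
  0 < eps -> 0 < r -> r ^+ 2 = a ^+ 2 + eps ^+ 2 -> 0 <= S ->
  a * L + g = 0 ->
  `|a| * S <= m * (r * L + a / r * g) + r * S + eps * (`|m| * `|L|).
Proof.
move=> e0 r0 r2 S0 /eqP; rewrite addrC addr_eq0 => /eqP ->.
have ar : `|a| <= r.
  by rewrite -(@ler_pXn2r _ 2) ?nnegrE ?normr_ge0 ?(ltW r0) //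
     real_normK ?num_real // r2 lerDl sqr_ge0.
have er : eps <= r.
  by rewrite -(@ler_pXn2r _ 2) ?nnegrE ?(ltW r0) ?(ltW e0) //
     r2 lerDr sqr_ge0.
have -> : m * (r * L + a / r * - (a * L)) = eps ^+ 2 / r * (m * L).
  have -> : eps ^+ 2 = r ^+ 2 - a ^+ 2 by rewrite r2 addrC addKr.
  by field; exact: lt0r_neq0.
have : - (eps * (`|m| * `|L|)) <= eps ^+ 2 / r * (m * L).
  have : `|eps ^+ 2 / r * (m * L)| <= eps * (`|m| * `|L|).
    rewrite normrM [`|m * L|]normrM ler_wpM2r ?mulr_ge0 //.
    rewrite ger0_norm; last first.
      by rewrite divr_ge0 ?sqr_ge0 // ltW.
    by rewrite ler_pdivrMr // expr2 ler_wpM2l // ltW.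
  by rewrite ler_norml => /andP[].
have := ler_wpM2r S0 ar; lra.
Qed.

Lemma div_scaled_grad a mu x :
  torus_C1 a -> (forall i, torus_C1 (partial i mu)) ->
  div (fun y => a y *: grad mu y) x =
  a x * \sum_i partial i (partial i mu) x +
  \sum_i partial i mu x * partial i a x.
Proof.
move=> aC muC; rewrite mulr_sumr -big_split; apply: eq_bigr => i _ /=.
rewrite -[RHS]/((fun y => a y * partial i (partial i mu) y +
  partial i mu y * partial i a y) x) -partialM //.
by congr (partial i _ x); apply/funext => y; rewrite !mxE.
Qed.

Lemma continuous_sum (g : 'I_d -> 'rV[R]_d -> R) :
  (forall i, continuous (g i)) -> continuous (fun y => \sum_i g i y).
Proof.
move=> cg x; have := @cvg_big R _ +%R 0 xpredT (@add_continuous R) _ (nbhs x)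
  (index_enum 'I_d) _ _ _ (fun i _ => cg i x).
by apply.
Qed.

(** As [a] may change sign and vanish on large sets, ellipticity arguments fail.
    Instead, [P := |a| |grad mu|^2] is compared with the divergence of
    [mu eta(a) grad mu], where [eta := smooth_abs eps], up to an error
    [eps |mu| |lap mu|]. *)
Lemma solenoidal_scaled_grad_eq0 a mu :
  torus_C1 a -> torus_C1 mu -> (forall i, torus_C1 (partial i mu)) ->
  (forall x, div (fun y => a y *: grad mu y) x = 0) ->
  forall x, a x *: grad mu x = 0.
Proof.
move=> aC muC dmuC div0 x.
pose S y := \sum_i partial i mu y ^+ 2.
pose L y := \sum_i partial i (partial i mu) y.
have S0 y : 0 <= S y by rewrite sumr_ge0 // => i _; exact: sqr_ge0.
have [_ ac _ _] := aC; have [_ muc _ dmuc] := muC.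
have aS0 : forall y, `|a y| * S y = 0.
  apply: (@eq0_of_approx_divergence _ _ _ (fun y => `|mu y| * `|L y|)).
  - move=> y.
    have cS : S z @[z --> y] --> S y.
      apply: continuous_sum => i z; exact: (cvgM (dmuc i z) (dmuc i z)).
    exact: (cvgM (cvg_norm (ac y)) cS).
  - move=> y.
    have cL : L z @[z --> y] --> L y.
      by apply: continuous_sum => i; case: (dmuC i).
    exact: (cvgM (cvg_norm (muc y)) (cvg_norm cL)).
  - by move=> y; rewrite mulr_ge0.
  move=> eps e0; pose r y := smooth_abs eps (a y).
  have rC : torus_C1 r.
    exact: torus_C1_comp (fun s => is_derive_smooth_abs s e0)
      (@continuous_derive_smooth_abs eps e0) aC.
  have fC i := torus_C1M rC (dmuC i).
  exists (fun i y => mu y * (r y * partial i mu y)) => [i|y].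
    exact: torus_C1M.
  have dr i : partial i r y = a y / r y * partial i a y.
    by rewrite (partial_comp (fun s => is_derive_smooth_abs s e0) aC).
  have := smooth_abs_weight_bound (mu y) e0 (smooth_abs_gt0 (a y) e0)
    (sqr_smooth_abs _ _) (S0 y).
  move=> /(_ (\sum_i partial i mu y * partial i a y) (L y)).
  rewrite -/(r y) -div_scaled_grad // => /(_ (div0 y)).
  congr (_ <= _ + _).
  rewrite mulrDr !mulr_sumr -!big_split /=; apply: eq_bigr => i _.
  rewrite partialM // partialM // dr; ring.
have [ax0|ax0] := eqVneq (a x) 0; first by rewrite ax0 scale0r.
apply/eqP; rewrite scaler_eq0 (negPf ax0) /=; apply/eqP/rowP => i.
move/eqP: (aS0 x); rewrite mulf_eq0 normr_eq0 (negPf ax0) /= psumr_eq0.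
  by move=> /allP /(_ i (mem_index_enum _)) /=; rewrite sqrf_eq0 !mxE => /eqP.
by move=> j _; exact: sqr_ge0.
Qed.
End degenerate_flux.

(** * Solutions at a fixed time *)

Lemma condB_C1 (R : realType) (b : R -> R) : condB b ->
  (forall s : R, is_derive s 1 b (b^`() s)) /\ continuous b^`().
Proof.
move=> [[db _] _]; split=> s.
  by rewrite derive1E; exact/derivableP/(db 0).
have /derivable1_diffP/differentiable_continuous := db 1%N isT s.
exact.
Qed.

Section slices.
Variables (R : realType) (d : nat).
Implicit Types (u : 'rV[R]_d -> R) (i : 'I_d).

Lemma torus_periodic_partial u i :
  torus_periodic u -> torus_periodic (partial i u).
Proof.
move=> pu j x; rewrite /partial /derive.
by under eq_fun do rewrite /= addrA !pu.
Qed.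

Lemma continuous_slice (T t : R) (u : R -> 'rV[R]_d -> R) :
  0 <= t <= T -> jointly_continuous T u -> continuous (u t).
Proof.
move=> tT /subspace_continuousP cu x.
have At : (`[0, T] `*` [set: 'rV[R]_d]) (t, x) by split; rewrite //= in_itv.
apply: (cvg_comp (fun y => (t, y)) _ _ (cu _ At)) => B /= AB.
have pair_cvg : (t, y) @[y --> x] --> (t, x).
  exact: (@cvg_pair _ _ _ _ (nbhs t) (nbhs x) _ _ _ (fun=> t) id
    (@cvg_cst _ t _ _ _) cvg_id).
apply: (@filterS _ (nbhs x)); last exact: (pair_cvg _ AB).
by move=> y; apply; split; rewrite //= in_itv.
Qed.

Lemma space_class_C_slice (T t : R) (k : nat) (u : R -> 'rV[R]_d -> R)
    (l : seq 'I_d) :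
  0 <= t <= T -> torus_periodic (u t) -> space_class_C T k u ->
  (size l < k)%N -> torus_C1 (partials l (u t)).
Proof.
move=> tT pu [du cu] lk; split.
- by elim: l {lk} => //= i l; exact: torus_periodic_partial.
- exact: (continuous_slice tT (cu l (ltnW lk))).
- by move=> i x; exact: du.
- by move=> i; exact: (continuous_slice tT (cu (i :: l) lk)).
Qed.

Lemma divB (V W : 'rV[R]_d -> 'rV[R]_d) x :
  (forall i, torus_C1 (fun y => V y 0 i)) ->
  (forall i, torus_C1 (fun y => W y 0 i)) ->
  div (fun y => V y - W y) x = div V x - div W x.
Proof.
move=> VC WC; rewrite /div -sumrB; apply: eq_bigr => i _.
have [_ _ dV _] := VC i; have [_ _ dW _] := WC i.
rewrite /partial -deriveB //; congr (derive _ _ _).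
by apply/funext => y; rewrite !mxE.
Qed.
End slices.

Theorem theorem8 (R : realType) (d : nat) (hd : (1 <= d <= 3)%N)
    (gamma T : R) (hgamma : 0 < gamma) (hT : 0 < T)
    (f : R -> R) (hf : condF f)
    (b1 b2 : R -> R) (hb1 : condB b1) (hb2 : condB b2)
    (phi1 mu1 phi2 mu2 : R -> 'rV[R]_d -> R)
    (hsol1 : smooth_CH_solution T gamma b1 f phi1 mu1)
    (hsol2 : smooth_CH_solution T gamma b2 f phi2 mu2)
    (t : R) (ht : 0 <= t <= T)
    (hphi : forall x, phi1 t x = phi2 t x)
    (hdt : forall x, dt T phi1 t x = dt T phi2 t x) :
  (forall x, mu1 t x = mu2 t x) /\
  (forall s, observed_range (phi1 t) (mu1 t) s -> b1 s = b2 s).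
Proof.
have phiE : phi1 t = phi2 t by exact/funext.
have muE x : mu1 t x = mu2 t x.
  by rewrite (CH_potential hsol1) // (CH_potential hsol2) // phiE.
split=> // _ [x /= gx <-].
set phi := phi1 t in phiE *; set mu := mu1 t in gx muE *.
have phiC : torus_C1 phi.
  by apply: (space_class_C_slice (l := [::]) ht _ (CH_phi_space hsol1));
    rewrite //; exact: (CH_periodic_phi hsol1).
have pmu : torus_periodic mu by exact: (CH_periodic_mu hsol1).
have muC : torus_C1 mu.
  exact: (space_class_C_slice (u := mu1) (l := [::]) ht pmu
    (CH_mu_space hsol1) isT).
have dmuC i : torus_C1 (partial i mu).
  exact: (space_class_C_slice (u := mu1) (l := [:: i]) ht pmu
    (CH_mu_space hsol1) isT).
have [db1 cdb1] := condB_C1 hb1; have [db2 cdb2] := condB_C1 hb2.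
have b1C := torus_C1_comp db1 cdb1 phiC.
have b2C := torus_C1_comp db2 cdb2 phiC.
have fluxC (b : R -> R) i : torus_C1 (fun y => b (phi y)) ->
    torus_C1 (fun y => (b (phi y) *: grad mu y) 0 i).
  move=> bC; rewrite (_ : (fun y => _) = (fun y => b (phi y) * partial i mu y)).
    exact: torus_C1M.
  by apply/funext => y; rewrite !mxE.
pose a y := b1 (phi y) - b2 (phi y).
have aC : torus_C1 a.
  have dc (s : R) :
      is_derive s 1 (fun s => b1 s - b2 s) (derive1 b1 s - derive1 b2 s).
    exact: (is_deriveB (db1 s) (db2 s)).
  have cdc : continuous (fun s : R => derive1 b1 s - derive1 b2 s).
    by move=> s; exact: (cvgB (cdb1 s) (cdb2 s)).
  exact: (torus_C1_comp dc cdc phiC).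
have div0 y : div (fun y => a y *: grad mu y) y = 0.
  rewrite (_ : (fun y => _) =
      fun y => b1 (phi y) *: grad mu y - b2 (phi y) *: grad mu y); last first.
    by apply/funext => z; rewrite /a scalerBl.
  rewrite divB; [|by move=> i; exact: fluxC..].
  rewrite -(CH_mass hsol1) // hdt (CH_mass hsol2) //.
  by rewrite -phiE (_ : mu2 t = mu) ?subrr //; apply/funext => z; rewrite muE.
have /eqP := solenoidal_scaled_grad_eq0 aC muC dmuC div0 x.
by rewrite scaler_eq0 (negPf gx) orbF subr_eq0 => /eqP.
Qed.
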